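(* Let $t$ be an indeterminate and set $x=\frac{t+t^{-1}}{2}$. For every integer $n\ge 0$ the following identities hold, as algebraic identities (i.e. identities of rational functions in $t$): $$ {}_3\phi_2 \left[ \begin{array}{c} t^{-2n},\ t^{2n},\ t\\ -t,\ -t^2 \end{array};\ t^2,\ t^2 \right] \;=\; \frac{2t^n}{1+t^{2n}} \;=\; \frac{1}{T_n(x)}. $$
   Context: $T_n$ denotes the degree-$n$ Chebyshev polynomial of the first kind; under $x=(t+t^{-1})/2$ one has $T_n(x)=(t^n+t^{-n})/2$. The q-Pochhammer symbol is $(a;q)_0=1$ and $(a;q)_m=\prod_{j=0}^{m-1}(1-aq^j)$ for integers $m>0$. The q-hypergeometric function ${}_3\phi_2$ is $$ {}_3\phi_2 \left[ \begin{array}{c} \alpha_1,\ \alpha_2,\ \alpha_3\\ \beta_1,\ \beta_2 \end{array};\ q,\ z \right]=\sum_{m=0}^{\infty}\frac{(\alpha_1;q)_m(\alpha_2;q)_m(\alpha_3;q)_m}{(\beta_1;q)_m(\beta_2;q)_m}\,\frac{z^m}{(q;q)_m}. $$ When $\alpha_1=q^{-n}$ with $n\ge 0$ an integer, all terms with $m>n$ vanish and the series is the finite sum over $0\le m\le n$. Here $q=t^2$, $z=t^2$, $\alpha_1=t^{-2n}=q^{-n}$. The identity is to be understood algebraically, since the two sides may fail to be well-defined for some particular values of $t$ and $x$. *)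

(* Defs.v *)
From HB Require Import structures.
From mathcomp Require Import all_boot all_order all_algebra.
From mathcomp Require Import boolp classical_sets fsbigop.

Set Implicit Arguments.
Unset Strict Implicit.
Unset Printing Implicit Defensive.

Import GRing.Theory.
Local Open Scope ring_scope.

Definition qpochhammer (R : nzRingType) (a q : R) (m : nat) : R :=
  \prod_(j < m) (1 - a * q ^+ j).

Definition phi32_term (K : fieldType) (a1 a2 a3 b1 b2 q z : K) (m : nat) : K :=
  (qpochhammer a1 q m * qpochhammer a2 q m * qpochhammer a3 q m)
    / (qpochhammer b1 q m * qpochhammer b2 q m)
    * (z ^+ m / qpochhammer q q m).

(* The field carries no topology: the sum over all of [nat] is the sum of a
   finitely supported family. It is the value of the series when the series
   terminates, and the junk value [0] when infinitely many terms are nonzero. *)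
Definition phi32 (K : fieldType) (a1 a2 a3 b1 b2 q z : K) : K :=
  \sum_(m \in [set: nat]) phi32_term a1 a2 a3 b1 b2 q z m.

Fixpoint chebyshevT (R : nzRingType) (n : nat) : {poly R} :=
  match n with
  | 0 => 1
  | n1.+1 => match n1 with
             | 0 => 'X
             | n2.+1 => 2%:R *: ('X * chebyshevT R n1) - chebyshevT R n2
             end
  end.

Definition ratfun_indet (F : fieldType) : {fraction {poly F}} :=
  tofrac ('X : {poly F}).

(* Main.v *)
(** The series is the terminating q-Saalschütz sum with parameters
    [a = t^(2n)], [b = t], [d = - t^(-2n)]. Reversing the products
    [(q^(-n); q)_m] and [(q^(1-n) / d; q)_m] turns that sum into a convolution
    satisfying a first-order recurrence in [n]. In the product formula which
    results, the same reversal leaves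
    [t^n (-1; q)_n / (-q; q)_n = 2 t^n / (1 + q^n)], where [q = t^2]. *)
Require Import Defs.
From HB Require Import structures.
From mathcomp Require Import all_boot all_order all_algebra.
From mathcomp Require Import classical_sets fsbigop.
From mathcomp Require Import ring.

Set Implicit Arguments.
Unset Strict Implicit.
Unset Printing Implicit Defensive.

Import GRing.Theory.
Local Open Scope ring_scope.

Lemma qpochhammer0 (R : nzRingType) (a q : R) : qpochhammer a q 0 = 1.
Proof. by rewrite /qpochhammer big_ord0. Qed.

Lemma qpochhammerS (R : nzRingType) (a q : R) (m : nat) :
  qpochhammer a q m.+1 = qpochhammer a q m * (1 - a * q ^+ m).
Proof. by rewrite /qpochhammer big_ord_recr. Qed.

Lemma qpochhammerSl (R : nzRingType) (a q : R) (m : nat) :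
  qpochhammer a q m.+1 = (1 - a) * qpochhammer (a * q) q m.
Proof.
rewrite /qpochhammer big_ord_recl expr0 mulr1; congr (_ * _).
by apply: eq_bigr => i _; rewrite lift0 exprS mulrA.
Qed.

Lemma qpochhammer_eq0_leq (R : comNzRingType) (a q : R) (m n : nat) :
  (m <= n)%N -> qpochhammer a q m = 0 -> qpochhammer a q n = 0.
Proof.
move=> /subnK <- a0; elim: (n - m)%N => [|k IHk]; first exact: a0.
by rewrite addSn qpochhammerS IHk mul0r.
Qed.

Lemma qpochhammer_neq0_leq (R : comNzRingType) (a q : R) (m n : nat) :
  (m <= n)%N -> qpochhammer a q n != 0 -> qpochhammer a q m != 0.
Proof. by move=> le_mn; apply: contra_neq => /(qpochhammer_eq0_leq le_mn). Qed.

Lemma qpochhammer_neq0 (R : idomainType) (a q : R) (n : nat) :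
  (forall j, 1 - a * q ^+ j != 0) -> qpochhammer a q n != 0.
Proof. by move=> a_neq; apply/prodf_neq0 => j _. Qed.

(** The last [m] factors are read backwards: [1 - x q^i = (1 - q^(-i) / x) (- x q^i)] for
    [k <= i < m + k]. *)
Lemma qpochhammer_rev (K : fieldType) (x q : K) (m k : nat) :
  x != 0 -> q != 0 ->
  qpochhammer x q (m + k) =
  qpochhammer (q / (x * q ^+ (m + k))) q m * qpochhammer x q k
    * (x ^+ m * \prod_(j < m) - q ^+ (k + j)).
Proof.
move=> x0 q0; elim: m k => [|m IHm] k.
  by rewrite qpochhammer0 big_ord0 expr0 !mul1r mulr1.
(* With the induction hypothesis at [k.+1], the factor [1 - x q^k] leaves [(x; q)_(k+1)] and becomes
   the last factor of the reversed product. *)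
rewrite addSnnS IHm !qpochhammerS big_ord_recl addn0.
under [in RHS]eq_bigr => i _ do rewrite lift0 addnS -addSn.
set P := \prod_(i < m) _; set Y := qpochhammer _ _ m.
rewrite addnS !exprS exprD; field.
by rewrite q0 x0 !expf_neq0.
Qed.

(* By induction on [n], as N -> N + 1: each summand for N + 1 is multiplied by
   (1 - C q^N)(1 - q^(N+1))
     = (1 - q^(N+1-m))(1 - C q^(N+m)) + q^(N+1-m) (1 - q^m)(1 - C q^(m-1)),
   where C = a b d; the two parts lower the second, resp. the first, index by
   one, and they recombine into (1 - a d q^N)(1 - b d q^N) times the summand
   for N. *)
Lemma qSaalschutz_convolution (K : fieldType) (a b d q : K) (n : nat) :
  qpochhammer (a * b * d) q n != 0 -> qpochhammer q q n != 0 ->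
  \sum_(m < n.+1)
     qpochhammer a q m * qpochhammer b q m
       / (qpochhammer (a * b * d) q m * qpochhammer q q m) * d ^+ m
       * (qpochhammer d q (n - m) / qpochhammer q q (n - m))
  = qpochhammer (a * d) q n * qpochhammer (b * d) q n
      / (qpochhammer (a * b * d) q n * qpochhammer q q n).
Proof.
set C := a * b * d.
pose A m := qpochhammer a q m * qpochhammer b q m
              / (qpochhammer C q m * qpochhammer q q m).
pose B m := qpochhammer d q m / qpochhammer q q m.
have AS m : qpochhammer C q m.+1 != 0 -> qpochhammer q q m.+1 != 0 ->
    A m.+1 * ((1 - C * q ^+ m) * (1 - q ^+ m.+1))
    = A m * ((1 - a * q ^+ m) * (1 - b * q ^+ m)).
  rewrite /A !qpochhammerS -exprS !mulf_eq0 !negb_or => /andP[C0 C1] /andP[q0 q1].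
  by field; rewrite C0 C1 q0 q1.
have BS m : qpochhammer q q m.+1 != 0 ->
    B m.+1 * (1 - q ^+ m.+1) = B m * (1 - d * q ^+ m).
  rewrite /B !qpochhammerS -exprS !mulf_eq0 !negb_or => /andP[q0 q1].
  by field; rewrite q0 q1.
move=> C_neq0 q_neq0.
have {C_neq0}C_neq0 m : (m <= n)%N -> qpochhammer C q m != 0.
  by move=> /qpochhammer_neq0_leq; apply.
have {q_neq0}q_neq0 m : (m <= n)%N -> qpochhammer q q m != 0.
  by move=> /qpochhammer_neq0_leq; apply.
elim: n => [|n IHn] in C_neq0 q_neq0 *.
  by rewrite big_ord1 subnn expr0 /A /B !qpochhammer0 !mulr1 !divr1 mulr1.
have /IHn{}IHn m : (m <= n)%N -> qpochhammer C q m != 0.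
  by move=> /leqW /C_neq0.
have {}IHn := IHn (fun m le_mn => q_neq0 m (leqW le_mn)).
have := C_neq0 n.+1 (leqnn _); have := q_neq0 n.+1 (leqnn _).
rewrite !qpochhammerS -exprS !mulf_eq0 !negb_or => /andP[q0 q1] /andP[C0 C1].
suff step : (1 - C * q ^+ n) * (1 - q ^+ n.+1)
    * (\sum_(m < n.+2) A m * d ^+ m * B (n.+1 - m)%N)
  = (1 - a * d * q ^+ n) * (1 - b * d * q ^+ n)
    * (\sum_(m < n.+1) A m * d ^+ m * B (n - m)%N).
  apply: (mulfI (mulf_neq0 C1 q1)); rewrite [LHS](step) IHn.
  by field; rewrite C0 C1 q0 q1.
rewrite mulr_sumr.
(* At [m = 0] the truncated [m.-1] is harmless, since [1 - q ^+ m] vanishes. *)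
transitivity (\sum_(m < n.+2) A m * d ^+ m * B (n.+1 - m)%N
                * ((1 - q ^+ (n.+1 - m)) * (1 - C * q ^+ (n + m)))
            + \sum_(m < n.+2) A m * d ^+ m * B (n.+1 - m)%N
                * (q ^+ (n.+1 - m) * ((1 - q ^+ m) * (1 - C * q ^+ m.-1)))).
  rewrite -big_split /=; apply: eq_bigr => -[[|m] /= lt_m] _.
    by rewrite subn0 addn0; ring.
  rewrite subSS; have /subnKC <- : (m <= n)%N by [].
  by rewrite addKn !(exprD, exprS); ring.
(* The first sum loses its last term and the second its first, both zero; after a shift of the
   second, both run over [m <= n]. *)
rewrite big_ord_recr /= subnn expr0 subrr mul0r mulr0 addr0.
rewrite [X in _ + X]big_ord_recl /= expr0 subrr mul0r !mulr0 add0r.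
rewrite -big_split mulr_sumr; apply: eq_bigr => -[m /= lt_m] _.
rewrite /bump /= add1n subSS subSn //.
transitivity (A m * d ^+ m * (1 - C * q ^+ (n + m))
                * (B (n - m).+1 * (1 - q ^+ (n - m).+1))
  + d ^+ m.+1 * B (n - m)%N * q ^+ (n - m)
      * (A m.+1 * ((1 - C * q ^+ m) * (1 - q ^+ m.+1)))).
  by ring.
rewrite AS ?BS ?C_neq0 ?q_neq0 ?ltnS ?leq_subr //.
have /subnKC <- : (m <= n)%N by [].
by rewrite addKn /C !(exprD, exprS); ring.
Qed.

Lemma qpochhammer_exprN_eq0 (K : fieldType) (q : K) (n m : nat) :
  q != 0 -> (n < m)%N -> qpochhammer (q ^- n) q m = 0.
Proof.
move=> q0 lt_nm; apply: (qpochhammer_eq0_leq lt_nm).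
by rewrite qpochhammerS mulVf ?expf_neq0 // subrr mulr0.
Qed.

(** For [m > n] the product [(q^(-n); q)_m] contains the zero factor of index [n], so the support is
    finite and the junk value of [phi32] does not arise. *)
Lemma phi32_terminating (K : fieldType) (a2 a3 b1 b2 q z : K) (n : nat) :
  q != 0 ->
  phi32 (q ^- n) a2 a3 b1 b2 q z
  = \sum_(m < n.+1) phi32_term (q ^- n) a2 a3 b1 b2 q z m.
Proof.
move=> q0; rewrite /phi32 (fsbigE (index_iota 0 n.+1)) ?iota_uniq //.
  by rewrite big_mkord; apply: eq_bigl => i; rewrite in_setT.
move=> m _; rewrite mem_index_iota -leqNgt => lt_nm.
by rewrite /phi32_term qpochhammer_exprN_eq0 // !mul0r.
Qed.

(** This is the convolution times [(q; q)_n / (d; q)_n]. Reversing [(q; q)_n] and [(d; q)_n] with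
    the same [m] gives the same product of powers of [q], which cancels; what remains is
    [d^m / q^m], and [z^m = q^m] removes the denominator. *)
Lemma qSaalschutz (K : fieldType) (a b d q : K) (n : nat) :
  q != 0 -> d != 0 ->
  qpochhammer (a * b * d) q n != 0 -> qpochhammer d q n != 0 ->
  qpochhammer q q n != 0 ->
  phi32 (q ^- n) a b (a * b * d) (q / (d * q ^+ n)) q q
  = qpochhammer (a * d) q n * qpochhammer (b * d) q n
      / (qpochhammer (a * b * d) q n * qpochhammer d q n).
Proof.
move=> q0 d0 C_neq0 d_neq0 q_neq0; rewrite phi32_terminating //.
transitivity (qpochhammer q q n / qpochhammer d q n * \sum_(m < n.+1)
     qpochhammer a q m * qpochhammer b q m
       / (qpochhammer (a * b * d) q m * qpochhammer q q m) * d ^+ m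
       * (qpochhammer d q (n - m) / qpochhammer q q (n - m))); last first.
  by rewrite qSaalschutz_convolution //; field; rewrite C_neq0 d_neq0 q_neq0.
rewrite mulr_sumr; apply: eq_bigr => -[m /= le_mn] _.
have := qpochhammer_neq0_leq (le_mn : (m <= n)%N) C_neq0.
have := qpochhammer_neq0_leq (le_mn : (m <= n)%N) q_neq0.
rewrite /phi32_term.
have /subnKC eqn : (m <= n)%N by [].
have rev_d := @qpochhammer_rev _ d q m (n - m) d0 q0.
have rev_q := @qpochhammer_rev _ q q m (n - m) q0 q0.
have qqn : q / (q * q ^+ n) = q ^- n by field; rewrite q0 expf_neq0.
rewrite eqn qqn in rev_q; rewrite eqn in rev_d.
move: rev_d rev_q; set P := \prod_(j < m) _ => rev_d rev_q qm_neq0 Cm_neq0.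
move: (q_neq0) (d_neq0); rewrite rev_q rev_d !mulf_eq0 !negb_or.
move=> /andP[/andP[qn qk] /andP[qm P0]] /andP[/andP[dn dk] /andP[dm _]].
by field; rewrite qk qm_neq0 Cm_neq0 dn dk P0 dm.
Qed.

(** With [u_n = t^n + t^(-n)], the recurrence of [chebyshevT] becomes
    [u_(n+2) = u_1 u_(n+1) - u_n]. *)
Lemma horner_chebyshevT (K : fieldType) (t : K) (n : nat) :
  t != 0 -> 2%:R != 0 :> K ->
  (chebyshevT K n).[(t + t^-1) / 2%:R] = (t ^+ n + t ^- n) / 2%:R.
Proof.
move=> t0 two0; elim/ltn_ind: n => -[|[|n]] IHn.
- by rewrite /= hornerC expr0 invr1 -mulr2n mulfV.
- by rewrite /= hornerX !expr1.
have -> : chebyshevT K n.+2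
        = 2%:R *: ('X * chebyshevT K n.+1) - chebyshevT K n by [].
rewrite hornerD hornerN hornerZ hornerM hornerX !IHn // !exprS.
by field; rewrite t0 two0 expf_neq0.
Qed.

(** The hypotheses on powers of [t] stand in for [t] being an indeterminate: they keep every
    denominator nonzero. *)
Lemma chebyshev_phi32 (K : fieldType) (t : K) (n : nat) :
  t != 0 -> (forall k, 1 + t ^+ k != 0) -> (forall k, 1 - t ^+ k.+1 != 0) ->
  phi32 (t ^- (2 * n)) (t ^+ (2 * n)) t (- t) (- t ^+ 2) (t ^+ 2) (t ^+ 2)
  = (2%:R * t ^+ n) / (1 + t ^+ (2 * n)).
Proof.
move=> t0 tD_neq0 tB_neq0; set q := t ^+ 2.
have q0 : q != 0 by rewrite expf_neq0.
have qn0 : q ^+ n != 0 by rewrite expf_neq0.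
have qt j : t * q ^+ j = t ^+ (2 * j).+1 by rewrite exprS exprM.
have one0 : 1 + q ^+ n != 0 by rewrite -exprM.
rewrite !exprM -/q.
have qq_neq0 : qpochhammer q q n != 0.
  by apply: qpochhammer_neq0 => j; rewrite -exprS -exprM mulnS tB_neq0.
have Nt_neq0 : qpochhammer (- t) q n != 0.
  by apply: qpochhammer_neq0 => j; rewrite mulNr opprK qt.
have Nq_neq0 : qpochhammer (- q) q n != 0.
  by apply: qpochhammer_neq0 => j; rewrite mulNr opprK -exprS -exprM.
(* The parameter [d] of the summation formula is [- q ^- n]. *)
have Cd : - t = q ^+ n * t * - q ^- n by field.
have qd : - q = q / (- q ^- n * q ^+ n) by rewrite mulNr mulVf // invrN1 mulrN1.
(* Taking [k = 0] reverses the whole product; as [q = t^2], this relates [(- t; q)_n] to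
   [(- t q^(-n); q)_n], the factor with parameter [b d]. *)
have rev_t := @qpochhammer_rev _ (- t) q n 0.
have rev_q := @qpochhammer_rev _ (- q) q n 0.
have eqt : q / (- t * q ^+ n) = - t / q ^+ n.
  by rewrite /q; field; rewrite qn0 oppr_eq0 t0.
have eqq : q / (- q * q ^+ n) = - q ^- n by field; rewrite qn0 oppr_eq0 q0.
move: rev_t rev_q; rewrite addn0 eqt eqq !oppr_eq0 !qpochhammer0 !mulr1.
move=> /(_ t0 q0) rev_t /(_ q0 q0) rev_q.
have d_neq0 : qpochhammer (- q ^- n) q n != 0.
  by move: Nq_neq0; rewrite rev_q mulf_eq0 negb_or => /andP[].
rewrite {1}Cd {1}qd qSaalschutz ?oppr_eq0 ?invr_eq0 -?Cd //.
have -> : q ^+ n * - q ^- n = -1 by rewrite mulrN mulfV.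
have -> : t * - q ^- n = - t / q ^+ n by rewrite mulrN mulNr.
(* Both sides are [(-1; q)_(n+1)], split off at its last and at its first factor. *)
have tele : qpochhammer (-1) q n * (1 + q ^+ n) = 2%:R * qpochhammer (- q) q n.
  have := qpochhammerS (-1) q n; rewrite qpochhammerSl !mulN1r !opprK.
  by move=> <-.
have -> : qpochhammer (-1) q n = 2%:R * qpochhammer (- q) q n / (1 + q ^+ n).
  by rewrite -tele mulfK.
(* The two reversals leave [(- q)^n / (- t)^n], which is the factor [t^n] of the result. *)
have qtt : - q = t * - t by rewrite mulrN.
move: (Nt_neq0); rewrite rev_q rev_t qtt [(t * - t) ^+ n]exprMn.
rewrite !mulf_eq0 !negb_or => /andP[X0 /andP[tn0 P0]].
by field; rewrite X0 tn0 P0 one0 d_neq0.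
Qed.

Lemma inv_chebyshevT (K : fieldType) (t : K) (n : nat) :
  t != 0 -> (forall k, 1 + t ^+ k != 0) ->
  (2%:R * t ^+ n) / (1 + t ^+ (2 * n))
  = 1 / (chebyshevT K n).[(t + t^-1) / 2%:R].
Proof.
move=> t0 tD_neq0.
(* The case [k = 0] of the hypothesis excludes characteristic 2. *)
have two0 : 2%:R != 0 :> K by have := tD_neq0 0%N; rewrite expr0 -mulr2n.
have := tD_neq0 (2 * n)%N.
rewrite horner_chebyshevT // mulnC exprM => tn_neq0.
have tn0 : t ^+ n != 0 by rewrite expf_neq0.
by field; rewrite two0 tn0 addrC -expr2.
Qed.

Theorem proposition3p1 (F : fieldType) (charF0 : [pchar F] =i pred0) (n : nat) :
  let t : {fraction {poly F}} := ratfun_indet F in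
  let x : {fraction {poly F}} := (t + t^-1) / 2%:R in
  phi32 (t ^- (2 * n)) (t ^+ (2 * n)) t (- t) (- t ^+ 2) (t ^+ 2) (t ^+ 2)
    = (2%:R * t ^+ n) / (1 + t ^+ (2 * n))
  /\ (2%:R * t ^+ n) / (1 + t ^+ (2 * n))
    = 1 / (chebyshevT {fraction {poly F}} n).[x].
Proof.
move=> t x.
have t0 : t != 0 by rewrite tofrac_eq0 polyX_eq0.
have two0 : 2%:R != 0 :> F by rewrite ((pcharf0P F).1 charF0).
(* The constant coefficient is 1 for [k > 0] and 2 for [k = 0]; the latter is where characteristic 0
   enters. *)
have tD_neq0 k : 1 + t ^+ k != 0.
  rewrite -tofracXn -tofrac1 -tofracD tofrac_eq0.
  apply/eqP => /(congr1 (fun p : {poly F} => p`_0)).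
  rewrite coefD coef1 coefXn coef0 /=; case: k => [|k] /eqP.
    by rewrite -mulr2n (negPf two0).
  by rewrite addr0 oner_eq0.
have tB_neq0 k : 1 - t ^+ k.+1 != 0.
  rewrite -tofracXn -tofrac1 -tofracB tofrac_eq0.
  apply/eqP => /(congr1 (fun p : {poly F} => p`_0)).
  by rewrite coefB coef1 coefXn coef0 subr0 => /eqP; rewrite oner_eq0.
(* [K] and [t] are given explicitly: inferring them by unification diverges. *)
split; first exact: (@chebyshev_phi32 {fraction {poly F}} t n t0 tD_neq0 tB_neq0).
exact: (@inv_chebyshevT {fraction {poly F}} t n t0 tD_neq0).
Qed.
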